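(* If $\mu$ is a finite measure on the Borel $\sigma$-algebra of the unit circle $\mathbb{T}$ and $U_{\varphi,\mu}$ is the position operator on $L^2(\mathbb{T},\mu)$, then the following assertions are pairwise equivalent. (a) $\mu$ is a Rajchman measure. (b) $\int_{\mathbb{T}} z^k g\,d\mu\to0$ as $|k|\to\infty$ for every $g\in L^p(\mathbb{T},\mu)$, for every $p\ge1$. (c) $\int_{\mathbb{T}} z^k g\,d\mu\to0$ as $|k|\to\infty$ for every $g\in L^p(\mathbb{T},\mu)$, for some $p\ge1$. (d) $\int_{\mathbb{T}} z^k g\,d\mu\to0$ as $|k|\to\infty$ for an arbitrary positive $g\in L^\infty(\mathbb{T},\mu)$. (e) $U_{\varphi,\mu}$ is weakly stable. (f) $\langle U^n_{\varphi,\mu}\psi\,;\psi\rangle\to0$ as $n\to\infty$ for an arbitrary $\psi\in L^\infty(\mathbb{T},\mu)$ with $0<|\psi|$. (g) $\langle U^n_{\varphi,\mu}1\,;1\rangle\to0$ as $n\to\infty$.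
   Context: All measures are positive. $k$ runs over the integers $\mathbb{Z}$ and $n$ over the positive integers. A finite measure $\mu$ on the Borel $\sigma$-algebra of $\mathbb{T}$ is a Rajchman measure if $\int_{\mathbb{T}}z^k\,d\mu\to0$ as $|k|\to\infty$. The position operator $U_{\varphi,\mu}$ on the complex Hilbert space $L^2(\mathbb{T},\mu)$ is the multiplication operator induced by the identity function $\varphi(z)=z$, that is, $(U_{\varphi,\mu}\psi)(z)=z\,\psi(z)$ $\mu$-a.e. for $z\in\mathbb{T}$, for every $\psi\in L^2(\mathbb{T},\mu)$; it is unitary. $\langle\cdot\,;\cdot\rangle$ is the inner product of $L^2(\mathbb{T},\mu)$, $\langle\psi\,;\phi\rangle=\int_{\mathbb{T}}\psi\overline{\phi}\,d\mu$, and $1$ denotes the unit function $1(z)=1$. An operator (bounded linear transformation) $T$ of a Hilbert space $\mathcal{H}$ into itself is weakly stable if $\lim_n|\langle T^nx\,;y\rangle|=0$ for every $x,y\in\mathcal{H}$. *)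

(* Defs.v *)
From HB Require Import structures.
From mathcomp Require Import all_boot all_order all_algebra.
From mathcomp Require Import all_classical all_reals all_analysis.
From mathcomp Require Import measurable_realfun complex lra.

Set Implicit Arguments.
Unset Strict Implicit.
Unset Printing Implicit Defensive.
Import Order.TTheory GRing.Theory Num.Theory.
Import numFieldNormedType.Exports.

Local Open Scope classical_set_scope.
Local Open Scope ring_scope.
Local Open Scope complex_scope.

Notation borel X := (g_sigma_algebraType (@open X)).

(* The topology of the complex plane is the one carried by the regular
   module R[i]^o; R[i] itself has no canonical topology. *)
Notation borelC R := (borel (R[i]^o)).

Definition circle (R : realType) : Type := set_type [set z : R[i]^o | `|z| = 1].

Definition cval (R : realType) (z : circle R) : R[i] := set_val z.

HB.instance Definition _ (R : realType) := Topological.on (circle R).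

Lemma circle1_subproof (R : realType) :
  (1 : R[i]^o) \in [set z : R[i]^o | `|z| = 1].
Proof. by rewrite inE /= normr1. Qed.

HB.instance Definition _ (R : realType) :=
  isPointed.Build (circle R) (@SigSub _ _ _ (1 : R[i]^o) (circle1_subproof R)).

Notation borelT R := (borel (circle R)).

(* The library norm `|z| of z : R[i] is a (nonnegative real) element of R[i];
   cabs z is the same number in R. *)
Definition cabs (R : realType) (z : R[i]) : R := complex.Re `|z|.

Section complex_measurability.
Context d (T : measurableType d) (R : realType).
Implicit Types f g : T -> R[i].

Local Notation C := R[i].

Lemma cabsE (z : C) : `|z| = (cabs z)%:C.
Proof. by rewrite /cabs RRe_real// normr_real. Qed.

Lemma cabs_ge0 (z : C) : 0 <= cabs z.
Proof. by rewrite -ler0c -cabsE. Qed.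

Lemma cabs_sqrt (z : C) :
  cabs z = Num.sqrt (complex.Re z ^+ 2 + complex.Im z ^+ 2).
Proof. by rewrite /cabs normc_def. Qed.

Lemma cabsM (z w : C) : cabs (z * w) = cabs z * cabs w.
Proof. by apply: complexI; rewrite -cabsE normrM !cabsE rmorphM. Qed.

Lemma cabs1 : cabs (1 : C) = 1.
Proof. by apply: complexI; rewrite -cabsE normr1. Qed.

Lemma cabs_cval (z : circle R) : cabs (cval z) = 1.
Proof. by apply: complexI; rewrite -cabsE; exact: (set_mem (valP z)). Qed.

Lemma Re_le_cabs (z : C) : `|complex.Re z| <= cabs z.
Proof. by rewrite -lecR -cabsE normc_ge_Re. Qed.

Lemma Im_le_cabs (z : C) : `|complex.Im z| <= cabs z.
Proof.
by rewrite cabs_sqrt -sqrtr_sqr ler_wsqrtr// lerDr sqr_ge0.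
Qed.

Lemma cabs_le (z : C) : cabs z <= `|complex.Re z| + `|complex.Im z|.
Proof.
rewrite cabs_sqrt -[leRHS]ger0_norm ?addr_ge0// -[leRHS]sqrtr_sqr.
rewrite ler_wsqrtr// sqrrD !real_normK ?num_real// lerD2r lerDl.
by rewrite mulrn_wge0// mulr_ge0.
Qed.

Lemma continuous_Re : continuous (@complex.Re R : R[i]^o -> R^o).
Proof.
move=> z; have FF : Filter (nbhs (z : R[i]^o)) := nbhs_filter _.
apply/cvgrPdist_lt => /= e e0.
apply/(@nbhs_ballP _ R[i]^o); exists e%:C => /=; first by rewrite ltcR.
move=> w /=; rewrite /ball/= cabsE ltcR; apply: le_lt_trans.
by rewrite -(raddfB (@complex.Re R)) Re_le_cabs.
Qed.

Lemma continuous_Im : continuous (@complex.Im R : R[i]^o -> R^o).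
Proof.
move=> z; have FF : Filter (nbhs (z : R[i]^o)) := nbhs_filter _.
apply/cvgrPdist_lt => /= e e0.
apply/(@nbhs_ballP _ R[i]^o); exists e%:C => /=; first by rewrite ltcR.
move=> w /=; rewrite /ball/= cabsE ltcR; apply: le_lt_trans.
by rewrite -(raddfB (@complex.Im R)) Im_le_cabs.
Qed.

Lemma continuous_borel_measurable (X : ptopologicalType) (h : X -> R) :
  continuous (h : X -> R^o) ->
  measurable_fun setT (h : borel X -> R).
Proof.
move=> /continuousP hc.
apply: (measurability _ (RGenOpens.measurableE R)) => //.
move=> _ [_ [a [b ->] <-]].
rewrite setTI; apply: sub_sigma_algebra; apply: hc.
exact: interval_open.
Qed.

Lemma measurable_ReIm f : measurable_fun setT (f : T -> borelC R) <->
  measurable_fun setT (fun x => complex.Re (f x)) /\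
  measurable_fun setT (fun x => complex.Im (f x)).
Proof.
split=> [mf|[mr mi]].
  split.
    exact: (measurableT_comp (continuous_borel_measurable continuous_Re) mf).
  exact: (measurableT_comp (continuous_borel_measurable continuous_Im) mf).
apply: (@measurability _ _ _ (borelC R) setT f (@open R[i]^o)) => //.
move=> _ [U oU <-]; rewrite setTI.
pose box (q : rat * rat * rat * rat) : set C :=
  [set z : C | ratr q.1.1.1 < complex.Re z < ratr q.1.1.2 /\
               ratr q.1.2 < complex.Im z < ratr q.2].
have -> : f @^-1` U = \bigcup_(q : rat * rat * rat * rat)
    (if `[< box q `<=` U >] then f @^-1` box q else set0).
  apply/seteqP; split=> [x Ux|x [q _]]; last first.
    by case: ifPn => // /asboolP qU /qU.
  have /(@nbhs_ballP _ R[i]^o)[e /= e0 eU] := open_nbhs_nbhs (conj oU Ux).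
  have eE : e = (complex.Re e)%:C by rewrite RRe_real// gtr0_real.
  have {}e0 : 0 < complex.Re e / 2 by rewrite divr_gt0// -ltcR -eE.
  set r := complex.Re e / 2 in e0.
  have ex (a : R) : exists p : rat * rat,
      a - r < ratr p.1 < a /\ a < ratr p.2 < a + r.
    have [p pa] : exists q : rat, (ratr q : R) \in `]a - r, a[.
      by apply: rat_in_itvoo; rewrite gtrBl.
    have [q qa] : exists q : rat, (ratr q : R) \in `]a, a + r[.
      by apply: rat_in_itvoo; rewrite ltrDl.
    by exists (p, q); move: pa qa; rewrite !in_itv.
  have [[a b] /= [/andP[a1 a2] /andP[b1 b2]]] := ex (complex.Re (f x)).
  have [[c d'] /= [/andP[c1 c2] /andP[d1 d2]]] := ex (complex.Im (f x)).
  exists (a, b, c, d') => //; case: ifPn => [_|/asboolP].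
    by rewrite /box/= a2 b1 c2 d1.
  apply => z [/= /andP[z1 z2] /andP[z3 z4]].
  apply: eU; rewrite /ball/= eE cabsE ltcR.
  rewrite (le_lt_trans (cabs_le _))// !raddfB/=.
  rewrite [ltRHS]splitr -/r; clear ex; clearbody r.
  rewrite ltrD//.
    by rewrite ltr_norml; apply/andP; split; lra.
  by rewrite ltr_norml; apply/andP; split; lra.
apply: countable_bigcupT_measurable => // q.
case: ifPn => // _.
rewrite (_ : f @^-1` box q =
    (fun x => complex.Re (f x)) @^-1` `](ratr q.1.1.1), (ratr q.1.1.2)[ `&`
    (fun x => complex.Im (f x)) @^-1` `](ratr q.1.2), (ratr q.2)[).
  by apply: measurableI; rewrite -[X in measurable X]setTI; [exact: mr|exact: mi].
by apply/seteqP; split=> x /=; rewrite !in_itv.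
Qed.

Lemma measurable_funMC f g :
  measurable_fun setT (f : T -> borelC R) ->
  measurable_fun setT (g : T -> borelC R) ->
  measurable_fun setT ((fun x => f x * g x) : T -> borelC R).
Proof.
move=> /measurable_ReIm[fr fi] /measurable_ReIm[gr gi].
apply/measurable_ReIm; split.
  rewrite (_ : (fun x => _) = (fun x => complex.Re (f x) * complex.Re (g x)
      - complex.Im (f x) * complex.Im (g x))).
    by apply: measurable_funB; apply: measurable_funM.
  by apply/funext => x; case: (f x); case: (g x).
rewrite (_ : (fun x => _) = (fun x => complex.Re (f x) * complex.Im (g x)
    + complex.Im (f x) * complex.Re (g x))).
  by apply: measurable_funD; apply: measurable_funM.
by apply/funext => x; case: (f x); case: (g x).
Qed.

Lemma measurable_cabs f :
  measurable_fun setT (f : T -> borelC R) ->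
  measurable_fun setT (fun x => cabs (f x)).
Proof.
move=> /measurable_ReIm[fr fi].
under eq_fun do rewrite cabs_sqrt.
apply: measurableT_comp.
  by apply: continuous_measurable_fun; exact: sqrt_continuous.
by apply: measurable_funD; exact: measurable_funX.
Qed.

End complex_measurability.

Lemma measurable_cval (R : realType) :
  measurable_fun setT (@cval R : borelT R -> borelC R).
Proof.
apply: (@measurability _ _ _ (borelC R) setT _ (@open R[i]^o)) => // _ [U oU <-]; rewrite setTI.
by apply: sub_sigma_algebra; exists U.
Qed.

Definition cLnorm d (T : measurableType d) (R : realType)
    (mu : {measure set T -> \bar R}) (p : \bar R) (f : T -> R[i]) : \bar R :=
  Lnorm mu p (fun x => (cabs (f x))%:E).

(* The complex space L^p(T, mu): mu-a.e. classes of Borel functions T -> C;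
   a class coerces to a representative. *)
Record cLspace d (T : measurableType d) (R : realType)
    (mu : {measure set T -> \bar R}) (p : \bar R) := CLspace {
  cLspace_class :> {mfun_ mu, T >-> borelC R} ;
  cLspace_finite : (cLnorm mu p cLspace_class < +oo)%E }.

Definition cintegral d (T : measurableType d) (R : realType)
    (mu : {measure set T -> \bar R}) (f : T -> R[i]) : R[i] :=
  (\int[mu]_x complex.Re (f x)) +i* (\int[mu]_x complex.Im (f x)).

Definition cdot d (T : measurableType d) (R : realType)
    (mu : {measure set T -> \bar R}) (f g : cLspace mu 2%:E) : R[i] :=
  cintegral mu (fun x => (f x : R[i]) * (g x : R[i])^*).

Arguments cdot {d T R} mu f g.

Section aeclass.
Context d (T : measurableType d) (R : realType).
Variable mu : {measure set T -> \bar R}.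
Variable f : T -> borelC R.
Hypothesis mf : measurable_fun setT f.

Definition mfun_of : {mfun T >-> borelC R} :=
  HB.pack f (isMeasurableFun.Build _ _ T (borelC R) f mf).

Definition aeclass : {mfun_ mu, T >-> borelC R} :=
  (\pi_({mfun_ mu, T >-> borelC R}) mfun_of)%qT.

Lemma aeclassE : {ae mu, forall x, aeclass x = f x}.
Proof.
have /eqP : (repr aeclass == mfun_of %[mod {mfun_ mu, T >-> borelC R}])%qT.
    by rewrite reprK.
by move=> /eqmodP/asboolP; apply: filterS => x /(_ I).
Qed.
End aeclass.

Section cLspace_theory.
Context d (T : measurableType d) (R : realType).

Lemma ae_eq_cLnorm2 (mu : {measure set T -> \bar R}) (f g : T -> R[i]) :
  measurable_fun setT (f : T -> borelC R) ->
  measurable_fun setT (g : T -> borelC R) ->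
  {ae mu, forall x, f x = g x} ->
  cLnorm mu 2%:E f = cLnorm mu 2%:E g.
Proof.
move=> mf mg fg; rewrite /cLnorm unlock; congr (_ `^ _)%E.
apply: ge0_ae_eq_integral => //.
- apply: (measurableT_comp (measurable_poweR _)).
  apply: measurableT_comp => //; apply/measurable_EFinP.
  exact: measurable_cabs.
- apply: (measurableT_comp (measurable_poweR _)).
  apply: measurableT_comp => //; apply/measurable_EFinP.
  exact: measurable_cabs.
- by move=> x _; exact: poweR_ge0.
- by move=> x _; exact: poweR_ge0.
- by apply: filterS fg => x -> _.
Qed.

Lemma Linfty_sub_L2 (mu : {finite_measure set T -> \bar R})
    (f : cLspace mu +oo%E) : (cLnorm mu 2%:E f < +oo)%E.
Proof.
have mf : measurable_fun setT (fun x => cabs (f x)).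
  exact: measurable_cabs.
have fy : (fun x => cabs (f x)) \in Lfun mu +oo%E.
  by apply/andP; split; rewrite inE//; exact: cLspace_finite.
have := @Lfun_subset _ _ _ mu 2%:E +oo%E (lee1n 2) (leey _)
  (fin_num_measure mu _ measurableT) (leey _) _ fy.
by move=> /andP[_]; rewrite inE.
Qed.

Definition Linfty_L2 (mu : {finite_measure set T -> \bar R})
    (f : cLspace mu +oo%E) : cLspace mu 2%:E :=
  CLspace (Linfty_sub_L2 f).

Lemma cst1_L2_subproof (mu : {finite_measure set T -> \bar R}) :
  (cLnorm mu 2%:E (aeclass mu (@measurable_cst _ _ T (borelC R) setT (1%R : R[i]))) < +oo)%E.
Proof.
rewrite (@ae_eq_cLnorm2 _ _ (cst 1))//; last exact: aeclassE.
rewrite /cLnorm.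
have := Lfun_cst mu 1 2; rewrite inE => /andP[_]; rewrite inE/=.
by rewrite /finite_norm; under [in X in _ -> X]eq_Lnorm do rewrite cabs1.
Qed.

Definition one_L2 (mu : {finite_measure set T -> \bar R}) : cLspace mu 2%:E :=
  CLspace (cst1_L2_subproof mu).

End cLspace_theory.

Section position_operator.
Variables (R : realType) (mu : {measure set (borelT R) -> \bar R}).

Lemma measurable_cvalM (f : {mfun_ mu, borelT R >-> borelC R}) :
  measurable_fun setT
    ((fun z => cval z * (f z : R[i])) : borelT R -> borelC R).
Proof. by apply: measurable_funMC => //; exact: measurable_cval. Qed.

Lemma position_op_subproof (f : cLspace mu 2%:E) :
  (cLnorm mu 2%:E (aeclass mu (measurable_cvalM f)) < +oo)%E.
Proof.
rewrite (ae_eq_cLnorm2 _ _ (aeclassE mu (measurable_cvalM f)))//; last first.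
  exact: measurable_cvalM.
rewrite /cLnorm; under eq_Lnorm do rewrite cabsM cabs_cval mul1r.
exact: cLspace_finite.
Qed.

Definition position_op (f : cLspace mu 2%:E) : cLspace mu 2%:E :=
  CLspace (position_op_subproof f).

Lemma position_opE (f : cLspace mu 2%:E) :
  {ae mu, forall z, position_op f z = cval z * (f z : R[i])}.
Proof. exact: aeclassE. Qed.

End position_operator.
Arguments position_op {R} mu f.

Definition weakly_stable (R : realType) (H : Type) (dot : H -> H -> R[i])
    (A : H -> H) : Prop :=
  forall x y : H, cabs (dot (iter n A x) y) @[n --> \oo] --> (0 : R).

(* The filter "|k| -> oo" on the integers. *)
Definition absz_infty : set_system int :=
  [set A | exists N : nat, forall k : int, (N <= absz k)%N -> A k].

#[global] Instance absz_infty_filter : ProperFilter absz_infty.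
Proof.
split; first by move=> [N /(_ N%:Z)]; apply.
split=> [|P Q [M MP] [N NQ]|P Q PQ [N NP]]; first by exists 0%N.
- exists (maxn M N) => k; rewrite geq_max => /andP[Mk Nk].
  by split; [exact: MP|exact: NQ].
- by exists N => k /NP /PQ.
Qed.

Definition Rajchman (R : realType) (mu : {measure set (borelT R) -> \bar R}) :=
  cintegral mu (fun z => cval z ^ k) @[k --> absz_infty] --> (0 : R[i]^o).

(* Main.v *)
Require Import Defs.
From mathcomp Require Import all_boot all_order all_algebra.
From mathcomp Require Import all_classical all_reals all_analysis.
From mathcomp Require Import complex.
From mathcomp Require Import measurable_realfun ess_sup_inf zify ring lra.
Import Order.TTheory GRing.Theory Num.Theory.
Import numFieldNormedType.Exports.
Local Open Scope classical_set_scope.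
Local Open Scope ring_scope.
Local Open Scope complex_scope.

(** The whole equivalence rests on one implication: if the Fourier
coefficients of mu vanish at infinity, then so do those of g mu for every
integrable g ([Rajchman_cvg0]).  Everything else is bookkeeping: on a finite
measure space L^oo is contained in L^p, and L^p in L^1, for p >= 1; the
product of an L^2 function with the conjugate of another is integrable; the
n-th iterate of the position operator multiplies by z^n; the assertions on
bounded functions may be tested on the unit function; and the coefficients of
index k and - k are conjugate since mu is positive, so that a limit along n
implies one along |k|.

For the key implication, call a real integrable function f vanishing when the
integrals of Re(z^k) f and Im(z^k) f tend to 0 as |k| tends to infinity.
Vanishing functions form an L^1-closed linear space N.  Its multipliers, that
is, the bounded measurable functions phi such that phi N is contained in N,
form an algebra which is closed under bounded pointwise limits, by dominated
convergence.  Multiplying z^k by Re z or Im z only shifts the index k by 1, so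
both coordinates are multipliers ([multiplier_shift]).  If phi is a
multiplier, then so is the indicator of {phi < a}: after an affine change this
is {t < 1/2} with t valued in [0, 1], and the polynomials
(1 - t^n)^(n 2^n) in t converge pointwise to its indicator
([cvg_threshold]).  The sets whose indicator is a multiplier thus form a
sigma-algebra which makes both coordinates measurable, so it contains every
Borel set ([multiplier_indic]).  When mu is Rajchman, the constant 1 lies in
N, hence so do all simple functions, and these are dense in L^1
([vanishing1_integrable]). *)

(** * Polynomial approximation of a threshold *)

Section threshold.
Context {R : realType}.
Implicit Types (x t : R) (m n : nat).

Lemma subr1X_ge x m : 0 <= x <= 1 -> 1 - m%:R * x <= (1 - x) ^+ m.
Proof.
move=> /andP[x0 x1]; elim: m => [|m IH]; first by rewrite expr0 mul0r subr0.
rewrite exprS; apply: (@le_trans _ _ ((1 - x) * (1 - m%:R * x))); last first.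
  by rewrite ler_wpM2l// subr_ge0.
have : 0 <= m%:R * (x * x) by rewrite !mulr_ge0.
by rewrite -natr1; lra.
Qed.

Lemma subr1X_le x m : 0 <= x <= 1 -> (1 - x) ^+ m * (1 + m%:R * x) <= 1.
Proof.
move=> /andP[x0 x1]; elim: m => [|m IH]; first by rewrite mul0r addr0 mul1r.
apply: le_trans IH; rewrite exprSr -mulrA ler_wpM2l ?exprn_ge0 ?subr_ge0//.
have : 0 <= m%:R * (x * x) by rewrite !mulr_ge0.
have : 0 <= x * x by rewrite mulr_ge0.
by rewrite -natr1; lra.
Qed.

(** With w the square root of x, the sequence n w^n is bounded by
1 / (1 - w). *)
Lemma cvg_natrMX x : 0 <= x < 1 -> n%:R * x ^+ n @[n --> \oo] --> (0 : R).
Proof.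
move=> /andP[x0 x1]; pose w := Num.sqrt x.
have w0 : 0 <= w by exact: sqrtr_ge0.
have w1 : w < 1 by rewrite -sqrtr1 ltr_sqrt.
have nw n : n%:R * w ^+ n * (1 - w) <= 1.
  have -> : n%:R * w ^+ n * (1 - w) = (\sum_(i < n) w ^+ n) * (1 - w).
    by rewrite sumr_const card_ord mulr_natl.
  apply: (@le_trans _ _ ((\sum_(i < n) w ^+ i) * (1 - w))).
    rewrite ler_wpM2r ?subr_ge0 ?(ltW w1)//; apply: ler_sum => i _.
    by rewrite ler_wiXn2l ?(ltW w1)// ltnW.
  rewrite mulrC -opprB mulNr -subrX1 opprB gerBl exprn_ge0//.
have cw : geometric ((1 - w)^-1) w @ \oo --> (0 : R).
  by apply: cvg_geometric; rewrite ger0_norm.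
apply: (squeeze_cvgr _ (cvg_cst 0) cw); apply: nearW => n /=.
rewrite mulr_ge0 ?exprn_ge0//= -(sqr_sqrtr x0) -/w -exprM mulnC exprM expr2.
by rewrite mulrA ler_wpM2r ?exprn_ge0// -[leRHS]mul1r ler_pdivlMr ?subr_gt0.
Qed.

(** For t < 1/2 the power is at least 1 - n (2t)^n, by Bernoulli; for
t >= 1/2 it is at most 1 / (1 + n (2t)^n).  The factor n in the exponent
makes the limit 0 also at t = 1/2. *)
Lemma cvg_threshold t : 0 <= t <= 1 ->
  (1 - t ^+ n) ^+ (n * 2 ^ n) @[n --> \oo] --> ((t < 2^-1)%R%:R : R).
Proof.
move=> /andP[t0 t1].
have tn n : 0 <= t ^+ n <= 1 by rewrite exprn_ge0// exprn_ile1.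
have E n : (n * 2 ^ n)%:R * t ^+ n = n%:R * (2 * t) ^+ n.
  by rewrite natrM natrX -mulrA exprMn.
have [th|th] := ltP t 2^-1.
- have c0 : 1 - n%:R * (2 * t) ^+ n @[n --> \oo] --> (1 : R).
    rewrite -[X in _ --> X]subr0; apply: cvgB; first exact: cvg_cst.
    by apply: cvg_natrMX; lra.
  rewrite mulr1n.
  apply: (@squeeze_cvgr _ _ _ R _ (fun=> 1) _ _ _ c0); last exact: cvg_cst.
  apply: nearW => n.
  have [a0 a1] := andP (tn n).
  by rewrite -E subr1X_ge//= exprn_ile1// ?subr_ge0 ?gerBl.
- rewrite mulr0n; apply: (squeeze_cvgr _ (cvg_cst 0) (@cvg_harmonic R)).
  near=> n; rewrite exprn_ge0 ?subr_ge0//=; last by case/andP: (tn n).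
  have n0 : (0 < n)%N by near: n; exact: nbhs_infty_gt.
  have [a0 a1] := andP (tn n).
  have /= := @subr1X_le (t ^+ n) (n * 2 ^ n) (tn n).
  rewrite E => le1.
  have v1 : 1 <= (2 * t) ^+ n by rewrite exprn_ege1//; lra.
  rewrite /harmonic /= -[leRHS]mul1r ler_pdivlMr//.
  apply: le_trans le1; rewrite ler_wpM2l ?exprn_ge0 ?subr_ge0//.
  by rewrite -natr1 addrC lerD2l ler_peMr.
Unshelve. all: by end_near. Qed.
End threshold.

(** * Vanishing functions and their multipliers *)

Section multipliers.
(* for the coercion of simple functions to functions *)
Import HBSimple.
Context {d} {T : measurableType d} {R : realType}.
Variable mu : {finite_measure set T -> \bar R}.
Context {I J : Type} {F : set_system I} {FF : Filter F}.
Variable u : J -> I -> T -> R.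
Hypothesis measurable_u : forall j i, measurable_fun setT (u j i).
Hypothesis u_le1 : forall j i x, `|u j i x| <= 1.
Implicit Types f g phi psi : T -> R.

(** The integrable functions f such that, for each index j, the integrals of
[u j i * f] tend to 0 along the filter F on the indices i.  The test
functions u are those of the section: measurable and bounded by 1. *)
Definition vanishing f := mu.-integrable setT (EFin \o f) /\
  forall j, (\int[mu]_x (u j i x * f x)) @[i --> F] --> (0 : R).

(** The bounded measurable functions which preserve the space of vanishing
functions by multiplication. *)
Definition multiplier phi := [/\ measurable_fun setT phi,
  exists M, forall x, `|phi x| <= M &
  forall f, vanishing f -> vanishing (fun x => phi x * f x)].

Lemma integrable_mull phi f M : measurable_fun setT phi ->
  (forall x, `|phi x| <= M) -> mu.-integrable setT (EFin \o f) ->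
  mu.-integrable setT (EFin \o (fun x => phi x * f x)).
Proof.
move=> mphi phiM intf.
have mf : measurable_fun setT f by apply/measurable_EFinP/(measurable_int mu).
apply: (@le_integrable _ _ _ mu _ measurableT _ (EFin \o (fun x => M * f x))).
- by apply/measurable_EFinP; exact: measurable_funM.
- move=> x _ /=; rewrite lee_fin !normrM ler_wpM2r//.
  by rewrite (le_trans (phiM x))// ler_norm.
- by under [X in _.-integrable _ X]eq_fun do rewrite /= EFinM;
    exact: integrableZl.
Qed.

Lemma integrable_test j i f : mu.-integrable setT (EFin \o f) ->
  mu.-integrable setT (EFin \o (fun x => u j i x * f x)).
Proof. by move=> intf; apply: (@integrable_mull _ _ 1). Qed.

Lemma vanishingD f g : vanishing f -> vanishing g ->
  vanishing (fun x => f x + g x).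
Proof.
move=> [intf f0] [intg g0]; split.
  by under [X in _.-integrable _ X]eq_fun do rewrite /= EFinD;
    exact: integrableD.
move=> j; rewrite -[X in _ --> X](addr0 0).
under eq_cvg => i.
  under eq_Rintegral do rewrite mulrDr.
  by rewrite RintegralD//; [over|exact: integrable_test..].
exact: cvgD.
Qed.

Lemma vanishingZ c f : vanishing f -> vanishing (fun x => c * f x).
Proof.
move=> [intf f0]; split.
  by under [X in _.-integrable _ X]eq_fun do rewrite /= EFinM;
    exact: integrableZl.
move=> j; rewrite -[X in _ --> X](mulr0 c).
under eq_cvg => i.
  under eq_Rintegral do rewrite mulrCA.
  by rewrite RintegralZl//; [over|exact: integrable_test].
exact: cvgMr.
Qed.

(** The vanishing functions are closed in L^1, since the test functions are
bounded by 1. *)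
Lemma vanishing_closed f (g_ : nat -> T -> R) :
  mu.-integrable setT (EFin \o f) -> (forall n, vanishing (g_ n)) ->
  (\int[mu]_x `|(f x - g_ n x)%:E|)%E @[n --> \oo] --> 0%E ->
  vanishing f.
Proof.
move=> intf vg /fine_cvgP[fing g0].
split=> // j; apply/cvgr0Pnorm_lt => e e0.
have e2 : 0 < e / 2 by rewrite divr_gt0.
have /cvgr0Pnorm_le /(_ _ e2) g0' := g0.
have [n [fn ne]] := filter_ex (filterI fing g0').
move: ne => /=; rewrite ger0_norm ?fine_ge0 ?integral_ge0//; move=> ne.
pose g := g_ n; have [intg {}g0] : vanishing g by exact: vg.
have fg : (\int[mu]_x `|(f x - g x)%:E| <= (e / 2)%:E)%E.
  by rewrite -[leLHS]fineK.
have intfg : mu.-integrable setT (EFin \o (fun x => f x - g x)).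
  by under [X in _.-integrable _ X]eq_fun do rewrite /= EFinB;
    exact: integrableB.
have /cvgr0Pnorm_lt /(_ _ e2) := g0 j.
apply: filterS => i gi.
have -> : \int[mu]_x (u j i x * f x) =
    \int[mu]_x (u j i x * (f x - g x)) + \int[mu]_x (u j i x * g x).
  rewrite -RintegralD//; [|exact: integrable_test..].
  by apply: eq_Rintegral => x _; rewrite -mulrDr subrK.
rewrite [ltRHS]splitr (le_lt_trans (ler_normD _ _))// ler_ltD//.
rewrite -lee_fin EFin_normr_Rintegral//; last exact: integrable_test.
apply: le_trans fg; apply: le_trans (le_abse_integral _ _ _) _ => //.
  by apply: (measurable_int mu); exact: integrable_test.
apply: ge0_le_integral => //.
- apply: measurableT_comp => //.
  by apply: (measurable_int mu); exact: integrable_test.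
- exact/(measurable_int mu)/(integrable_norm intfg).
- by move=> x _; rewrite /= lee_fin normrM ler_piMl.
Qed.

Lemma multiplier_cst c : multiplier (fun=> c).
Proof.
split; first exact: measurable_cst.
  by exists `|c|.
by move=> f; exact: vanishingZ.
Qed.

Lemma multiplierD phi psi : multiplier phi -> multiplier psi ->
  multiplier (fun x => phi x + psi x).
Proof.
move=> [mf [M fM] fv] [mg [N gN] gv]; split; first exact: measurable_funD.
  by exists (M + N) => x; rewrite (le_trans (ler_normD _ _))// lerD.
move=> f vf; under [X in vanishing X]eq_fun do rewrite mulrDl.
by apply: vanishingD; [exact: fv|exact: gv].
Qed.

Lemma multiplierM phi psi : multiplier phi -> multiplier psi ->
  multiplier (fun x => phi x * psi x).
Proof.
move=> [mf [M fM] fv] [mg [N gN] gv]; split; first exact: measurable_funM.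
  by exists (M * N) => x; rewrite normrM ler_pM.
move=> f vf; under [X in vanishing X]eq_fun do rewrite -mulrA.
by apply: fv; exact: gv.
Qed.

Lemma multiplierB phi psi : multiplier phi -> multiplier psi ->
  multiplier (fun x => phi x - psi x).
Proof.
move=> mphi mpsi; under [X in multiplier X]eq_fun do rewrite -mulN1r.
by apply: multiplierD => //; apply: multiplierM => //; exact: multiplier_cst.
Qed.

Lemma multiplierX phi n : multiplier phi -> multiplier (fun x => phi x ^+ n).
Proof.
move=> mphi; elim: n => [|n IH]; first exact: multiplier_cst.
by under [X in multiplier X]eq_fun do rewrite exprS; exact: multiplierM.
Qed.

Lemma multiplier_lim (phi_ : nat -> T -> R) phi M :
  (forall n, multiplier (phi_ n)) -> (forall n x, `|phi_ n x| <= M) ->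
  (forall x, phi_ n x @[n --> \oo] --> phi x) -> multiplier phi.
Proof.
move=> mphi_ phiM cphi.
have mphi : measurable_fun setT phi.
  apply: (@measurable_fun_cvg _ _ _ _ phi_) => //.
  by move=> n; case: (mphi_ n).
have phibnd x : `|phi x| <= M.
  rewrite -(cvg_lim _ (cvg_norm (cphi x)))//.
  apply: limr_le; last exact: nearW.
  by apply/cvg_ex; eexists; exact: (cvg_norm (cphi x)).
split=> //; first by exists M.
move=> f vf; have [intf _] := vf.
have intM : mu.-integrable setT (EFin \o (fun x => M * `|f x|)).
  apply: (@integrable_mull (fun=> M) _ `|M|) => //.
  exact: integrable_norm.
have intphi : mu.-integrable setT (EFin \o (fun x => phi x * f x)).
  exact: (@integrable_mull _ _ M).
have intphi_ n : mu.-integrable setT (EFin \o (fun x => phi_ n x * f x)).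
  by apply: (@integrable_mull _ _ M) => //; case: (mphi_ n).
apply: (@vanishing_closed _ (fun n x => phi_ n x * f x)) => //.
  by move=> n; case: (mphi_ n) => _ _; exact.
have cphif : {ae mu, forall x, setT x ->
    (phi_ n x * f x)%:E @[n --> \oo] --> (phi x * f x)%:E}.
  by apply: aeW => x _; apply: cvg_EFin; [exact: nearW|exact: cvgMl].
have bphif : {ae mu, forall x n, setT x ->
    (`|(phi_ n x * f x)%:E| <= (M * `|f x|)%:E)%E}.
  by apply: aeW => x n _; rewrite /= lee_fin normrM ler_wpM2r.
have [_ + _] := dominated_convergence measurableT
  (fun n => measurable_int mu (intphi_ n)) (measurable_int mu intphi)
  cphif intM bphif.
apply: cvg_trans; apply: near_eq_cvg; apply: nearW => n /=.
by apply: eq_integral => x _; rewrite /= distrC.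
Qed.

Lemma multiplier_lt phi a : multiplier phi ->
  multiplier (\1_[set x | phi x < a]).
Proof.
move=> mphi; have [_ [M phiM] _] := mphi.
pose N := `|M| + `|a| + 1; pose c := (2 * N)^-1.
have N0 : 0 < N by rewrite ltr_wpDl// addr_ge0.
have c0 : 0 < c by rewrite invr_gt0 mulr_gt0.
have cN : c * N = 2^-1 by rewrite /c invfM -mulrA mulVf ?mulr1// gt_eqF.
(* an affine image of phi, valued in [0, 1] *)
pose t x := 2^-1 + c * (phi x - a).
have mt : multiplier t.
  apply: multiplierD; first exact: multiplier_cst.
  apply: multiplierM; first exact: multiplier_cst.
  by apply: multiplierB => //; exact: multiplier_cst.
have t01 x : 0 <= t x <= 1.
  have : `|phi x - a| <= N.
    rewrite (le_trans (ler_normB _ _))// /N -addrA lerD ?lerDl//.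
    by rewrite (le_trans (phiM x))// ler_norm.
  rewrite -(ler_pM2l c0) cN -[X in X * _]gtr0_norm// -normrM ler_norml.
  by rewrite /t => /andP[? ?]; apply/andP; split; lra.
have -> : \1_[set x | phi x < a] = (fun x => (t x < 2^-1)%R%:R) :> (T -> R).
  apply/funext => x; rewrite indicE; congr (_%:R).
  rewrite /t gtrDl pmulr_rlt0// subr_lt0; congr nat_of_bool.
  by apply/idP/idP; rewrite inE.
apply: (@multiplier_lim (fun n x => (1 - t x ^+ n) ^+ (n * 2 ^ n)) _ 1).
- move=> n; apply: multiplierX; apply: multiplierB; first exact: multiplier_cst.
  exact: multiplierX.
- move=> n x; have /andP[t0 t1] := t01 x.
  rewrite ger0_norm ?exprn_ge0 ?exprn_ile1// ?subr_ge0 ?exprn_ile1//.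
  by rewrite gerBl exprn_ge0.
- by move=> x; exact: cvg_threshold.
Qed.

Lemma multiplier_sigma_algebra :
  sigma_algebra setT [set A | multiplier (\1_A : T -> R)].
Proof.
apply/sigma_algebraP => //; split => /=.
- by rewrite indicT; exact: multiplier_cst.
- move=> A B BA mA mB /=.
  have -> : \1_(A `\` B) = (fun x => \1_A x - \1_B x) :> (T -> R).
    apply/funext => x; rewrite setDE indicI indicC /=.
    have := BA x; rewrite !indicE.
    have [xA|xA] := boolP (x \in A); have [xB|xB] := boolP (x \in B);
      rewrite ?subr0 ?subrr ?mulr0 ?mulr1 ?mul0r//.
    by move/set_mem : xB => /[swap] /[apply] /mem_set; rewrite (negPf xA).
  exact: multiplierB.
- move=> A ndA mA; apply: (@multiplier_lim (fun n => \1_(A n)) _ 1) => //.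
    by move=> n x; rewrite indicE; case: (_ \in _); rewrite ?normr1 ?normr0.
  move=> x; apply: cvg_near_cst.
  have [[N _ NAx]|nAx] := pselect ((\bigcup_i A i) x).
    exists N => // n /= Nn; rewrite !indicE !mem_set//; first by exists N.
    by have /subsetPset := ndA _ _ Nn; apply.
  apply: nearW => n; rewrite !indicE !memNset// => Anx.
  by apply: nAx; exists n.
- move=> A B mA mB /=; rewrite indicI; exact: multiplierM.
Qed.

Hypothesis vanishing1 : vanishing (fun=> 1).

(** Simple functions are multipliers, hence vanishing since 1 is, and they
are dense in L^1. *)
Lemma vanishing_integrable f :
  (forall A, measurable A -> multiplier (\1_A : T -> R)) ->
  mu.-integrable setT (EFin \o f) -> vanishing f.
Proof.
move=> mA intf.
have [g_ [intg cg g0]] := approximation_sfun_integrable measurableT intf.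
apply: (@vanishing_closed _ (fun n => g_ n : T -> R)) => //.
move=> n; rewrite (_ : (g_ n : T -> R) = (fun x => g_ n x * 1)); last first.
  by apply/funext => x; rewrite mulr1.
suff : multiplier (g_ n) by case=> _ _; exact.
rewrite (_ : (g_ n : T -> R) = (fun x => \sum_(y \in range (g_ n))
    y * \1_(g_ n @^-1` [set y]) x)); last by apply/funext => x; exact: fimfunE.
under [X in multiplier X]eq_fun do rewrite fsbig_finite//.
elim: (finmap.enum_fset _) => [|y s IH].
  by under [X in multiplier X]eq_fun do rewrite big_nil; exact: multiplier_cst.
under [X in multiplier X]eq_fun do rewrite big_cons.
apply: multiplierD => //; apply: multiplierM; first exact: multiplier_cst.
by apply: mA; rewrite -[X in measurable X]setTI; exact: measurable_funP1.
Qed.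
End multipliers.

(** * Limits and powers of complex numbers *)

Section complex_limits.
Context {R : realType} {I : Type} {F : set_system I} {FF : Filter F}.
Implicit Types f : I -> R[i].

Lemma cvgC0_cabs f :
  f i @[i --> F] --> (0 : R[i]^o) <-> cabs (f i) @[i --> F] --> (0 : R).
Proof.
split=> [f0|f0].
  apply/cvgr0Pnorm_lt => e e0.
  have /(@cvgr0Pnorm_lt _ R[i]^o) /(_ e%:C) := f0.
  rewrite ltcR => /(_ e0); apply: filterS => i.
  by rewrite cabsE ltcR ger0_norm ?cabs_ge0.
apply/(@cvgr0Pnorm_lt _ R[i]^o) => e e0.
have eE : e = (complex.Re e)%:C by rewrite RRe_real// gtr0_real.
rewrite eE ltcR in e0.
have /cvgr0Pnorm_lt /(_ _ e0) := f0.
by apply: filterS => i; rewrite eE cabsE ltcR ger0_norm ?cabs_ge0.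
Qed.

Lemma cvgC0_ReIm f : f i @[i --> F] --> (0 : R[i]^o) <->
  complex.Re (f i) @[i --> F] --> (0 : R) /\
  complex.Im (f i) @[i --> F] --> (0 : R).
Proof.
rewrite cvgC0_cabs; split=> [f0|[r0 i0]].
  split; apply/cvgr0Pnorm_lt => e e0;
    have /cvgr0Pnorm_lt /(_ _ e0) := f0; apply: filterS => i;
    rewrite ger0_norm ?cabs_ge0//; apply: le_lt_trans;
    [exact: Re_le_cabs|exact: Im_le_cabs].
have ri0 : `|complex.Re (f i)| + `|complex.Im (f i)| @[i --> F] --> (0 : R).
  by rewrite -[X in _ --> X]addr0; apply: cvgD;
    rewrite -[X in _ --> X](@normr0 _ R); exact: cvg_norm.
apply: (squeeze_cvgr _ (cvg_cst 0) ri0); apply: nearW => i.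
by rewrite cabs_ge0 cabs_le.
Qed.

End complex_limits.

Section circle_powers.
Context {R : realType}.
Implicit Types (z : circle R) (k : int).

Lemma normr_cval z : `|cval z| = 1.
Proof. by rewrite cabsE cabs_cval. Qed.

Lemma cval_neq0 z : cval z != 0.
Proof. by rewrite -normr_gt0 normr_cval ltr01. Qed.

Lemma cvalV z : (cval z)^-1 = (cval z)^*.
Proof. by rewrite invC_norm normr_cval expr1n invr1 mul1r. Qed.

Lemma cvalXN z k : cval z ^ (- k) = (cval z ^ k)^*.
Proof.
rewrite -exprz_inv cvalV; case: k => n.
  by rewrite -!exprnP rmorphXn.
by rewrite !NegzE -!exprnN rmorphV ?unitfE ?expf_neq0 ?cval_neq0// rmorphXn.
Qed.

Lemma cabs_cvalX z k : cabs (cval z ^ k) = 1.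
Proof.
apply: complexI; rewrite -cabsE; case: k => n.
  by rewrite -exprnP normrX normr_cval expr1n.
by rewrite NegzE -exprnN normfV normrX normr_cval expr1n invr1.
Qed.

Lemma measurable_cvalX k :
  measurable_fun setT ((fun z => cval z ^ k) : borelT R -> borelC R).
Proof.
have mX n : measurable_fun setT ((fun z => cval z ^+ n) : borelT R -> borelC R).
  elim: n => [|n IH]; first exact: measurable_cst.
  under eq_fun do rewrite exprS.
  by apply: measurable_funMC => //; exact: measurable_cval.
case: k => n; first exact: mX.
have /measurable_ReIm[mr mi] := mX n.+1.
apply/measurable_ReIm; rewrite NegzE.
split.
  rewrite (_ : (fun z => _) = (fun z => complex.Re (cval z ^+ n.+1)))//.
  by apply/funext => z; rewrite cvalXN -exprnP; case: (_ ^+ _).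
rewrite (_ : (fun z => _) = (fun z => - complex.Im (cval z ^+ n.+1))).
  exact: measurableT_comp.
by apply/funext => z; rewrite cvalXN -exprnP; case: (_ ^+ _).
Qed.

End circle_powers.

(** * Rajchman measures *)

(** The test functions on the circle: [trig true k] is the real part of z^k
and [trig false k] its imaginary part. *)
Definition trig {R : realType} (j : bool) (k : int) (z : circle R) : R :=
  if j then complex.Re (cval z ^ k) else complex.Im (cval z ^ k).

Arguments trig : simpl never.

Section rajchman_core.
Context {R : realType}.
Variable mu : {finite_measure set (borelT R) -> \bar R}.
Implicit Types (z : circle R) (k : int).

Lemma measurable_trig j k : measurable_fun setT (trig j k : borelT R -> R).
Proof. by have /measurable_ReIm[] := @measurable_cvalX R k; case: j. Qed.

Lemma trig_le1 j k z : `|trig j k z| <= 1.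
Proof.
rewrite -(cabs_cvalX z k) /trig.
by case: j; [exact: Re_le_cabs|exact: Im_le_cabs].
Qed.

Local Notation vanishing := (vanishing mu (F := absz_infty) trig).
Local Notation multiplier := (multiplier mu (F := absz_infty) trig).

Lemma cvg_shift (g : int -> R) (l : R) m : g k @[k --> absz_infty] --> l ->
  g (k + m) @[k --> absz_infty] --> l.
Proof.
move=> gl; apply: cvg_trans gl => A [N NA]; exists (N + absz m)%N => k Nk.
by apply: NA; lia.
Qed.

Lemma trigD k z :
  trig true (k + 1) z = trig true k z * complex.Re (cval z)
    - trig false k z * complex.Im (cval z) /\
  trig false (k + 1) z = trig true k z * complex.Im (cval z)
    + trig false k z * complex.Re (cval z).
Proof.
rewrite /trig exprzDr ?unitfE ?cval_neq0// expr1z.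
by case: (_ ^ k) => a b; case: (cval z).
Qed.

Lemma trigB k z :
  trig true (k - 1) z = trig true k z * complex.Re (cval z)
    + trig false k z * complex.Im (cval z) /\
  trig false (k - 1) z = - (trig true k z * complex.Im (cval z))
    + trig false k z * complex.Re (cval z).
Proof.
rewrite /trig exprzDr ?unitfE ?cval_neq0// cvalXN expr1z.
case: (_ ^ k) => a b; case: (cval z) => c d /=.
by rewrite !mulrN opprK.
Qed.

(** A bounded function h is a multiplier as soon as its product with a test
function of index k is a combination, with coefficients independent of k, of
test functions of indices k + 1 and k - 1: the filter |k| -> oo is invariant
under translation. *)
Lemma multiplier_shift (h : circle R -> R) :
  measurable_fun setT (h : borelT R -> R) -> (forall z, `|h z| <= 1) ->
  (forall j, exists j' a b, forall k z,
     trig j k z * h z = a * trig j' (k + 1) z + b * trig j' (k - 1) z) ->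
  multiplier h.
Proof.
move=> mh h1 hj; split=> //; first by exists 1.
move=> f [intf f0]; split=> [|j]; first exact: (@integrable_mull _ _ _ _ _ _ 1).
have [j' [a [b jE]]] := hj j.
have intj k : mu.-integrable setT (EFin \o (fun z => trig j' k z * f z)).
  apply: (@integrable_test _ _ _ mu _ _ trig) => //.
    exact: measurable_trig.
  exact: trig_le1.
have intc c k :
    mu.-integrable setT (EFin \o (fun z => c * (trig j' k z * f z))).
  under [X in _.-integrable _ X]eq_fun do rewrite /= EFinM.
  by apply: integrableZl => //; exact: intj.
have E k : \int[mu]_z (trig j k z * (h z * f z)) =
    a * \int[mu]_z (trig j' (k + 1) z * f z) +
    b * \int[mu]_z (trig j' (k - 1) z * f z).
  rewrite -!RintegralZl// -RintegralD//.
  by apply: eq_Rintegral => z _; rewrite mulrA jE mulrDl !mulrA.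
have sh m : \int[mu]_z (trig j' (k + m) z * f z) @[k --> absz_infty]
    --> (0 : R).
  exact: (@cvg_shift (fun i => \int[mu]_z (trig j' i z * f z)) 0 m (f0 j')).
rewrite -[X in _ --> X]addr0 -[X in _ --> X + _](mulr0 a).
rewrite -[X in _ --> _ + X](mulr0 b).
under eq_cvg do rewrite E.
by apply: cvgD; apply: cvgMr; exact: sh.
Qed.

Lemma multiplier_Re : multiplier (fun z => complex.Re (cval z)).
Proof.
apply: multiplier_shift.
- exact: ((measurable_ReIm _).1 (@measurable_cval R)).1.
- by move=> z; rewrite (le_trans (Re_le_cabs _)) ?cabs_cval.
- move=> j; exists j, 2^-1, 2^-1 => k z.
  have [D1 D2] := trigD k z; have [B1 B2] := trigB k z.
  by case: j; rewrite ?D1 ?D2 ?B1 ?B2; field.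
Qed.

Lemma multiplier_Im : multiplier (fun z => complex.Im (cval z)).
Proof.
apply: multiplier_shift.
- exact: ((measurable_ReIm _).1 (@measurable_cval R)).2.
- by move=> z; rewrite (le_trans (Im_le_cabs _)) ?cabs_cval.
- move=> j; exists (~~ j), (if j then 2^-1 else - 2^-1),
    (if j then - 2^-1 else 2^-1) => k z.
  have [D1 D2] := trigD k z; have [B1 B2] := trigB k z.
  by case: j; rewrite ?D1 ?D2 ?B1 ?B2; field.
Qed.

Lemma multiplier_indic (A : set (borelT R)) : measurable A -> multiplier (\1_A).
Proof.
move=> mA.
pose S : set (set (circle R)) := [set A | multiplier (\1_A)].
have sS : sigma_algebra setT S.
  apply: multiplier_sigma_algebra; [exact: measurable_trig|exact: trig_le1].
suff : measurable_fun setT (@cval R : g_sigma_algebraType S -> borelC R).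
  move=> mS; suff : <<s S >> A by rewrite sigma_algebra_id.
  (* the topology of the circle is induced by the plane *)
  move: A mA; apply: smallest_sub => [|U [V oV <-]].
    exact: smallest_sigma_algebra.
  rewrite -[X in <<s S >> X]setTI; apply: mS => //.
  exact: sub_sigma_algebra.
have mlt (h : circle R -> R) : multiplier h ->
    measurable_fun setT (h : g_sigma_algebraType S -> R).
  move=> mh.
  apply: (measurability _ (RGenInftyO.measurableE R)) => //.
  move=> _ [_ [a ->] <-]; rewrite setTI; apply: sub_sigma_algebra.
  rewrite /S /= (_ : _ @^-1` _ = [set z | h z < a]); last first.
    by apply/seteqP; split=> z /=; rewrite in_itv.
  by apply: multiplier_lt => //; [exact: measurable_trig|exact: trig_le1].
apply/measurable_ReIm; split; apply: mlt.
- exact: multiplier_Re.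
- exact: multiplier_Im.
Qed.

Lemma vanishing1_integrable f : vanishing (fun=> 1) ->
  mu.-integrable setT (EFin \o f) -> vanishing f.
Proof.
move=> v1; apply: vanishing_integrable => //.
- exact: measurable_trig.
- exact: trig_le1.
- exact: multiplier_indic.
Qed.

End rajchman_core.

(** * Integrals of complex functions *)

Section complex_integrals.
Context {d} {T : measurableType d} {R : realType}.
Implicit Types f g : T -> R[i].

(** Integrability of a complex function, by real and imaginary parts, as
for [cintegral]. *)
Definition cintegrable (mu : {measure set T -> \bar R}) f :=
  mu.-integrable setT (EFin \o (fun x => complex.Re (f x))) /\
  mu.-integrable setT (EFin \o (fun x => complex.Im (f x))).

Lemma cintegrable_le (mu : {measure set T -> \bar R}) f (h : T -> R) :
  measurable_fun setT (f : T -> borelC R) -> (forall x, cabs (f x) <= h x) ->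
  mu.-integrable setT (EFin \o h) -> cintegrable mu f.
Proof.
move=> /measurable_ReIm[mr mi] fh inth.
by split; apply: le_integrable inth => //; try exact/measurable_EFinP;
  move=> x _; rewrite /= lee_fin; apply: le_trans (ler_norm _);
  apply: le_trans (fh x); [exact: Re_le_cabs|exact: Im_le_cabs].
Qed.

Lemma ae_eq_cintegral (mu : {measure set T -> \bar R}) f g :
  measurable_fun setT (f : T -> borelC R) ->
  measurable_fun setT (g : T -> borelC R) ->
  {ae mu, forall x, f x = g x} -> cintegral mu f = cintegral mu g.
Proof.
move=> /measurable_ReIm[fr fi] /measurable_ReIm[gr gi] fg.
rewrite /cintegral; congr (_ +i* _); congr fine;
  apply: ae_eq_integral => //; try exact/measurable_EFinP;
  by apply: filterS fg => x -> _.
Qed.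

Lemma measurable_conjc f : measurable_fun setT (f : T -> borelC R) ->
  measurable_fun setT ((fun x => (f x)^*) : T -> borelC R).
Proof.
move=> /measurable_ReIm[fr fi]; apply/measurable_ReIm; split.
  by rewrite (_ : (fun x => _) = (fun x => complex.Re (f x)))//;
    apply/funext => x; case: (f x).
rewrite (_ : (fun x => _) = (fun x => - complex.Im (f x))).
  exact: measurableT_comp.
by apply/funext => x; case: (f x).
Qed.

Lemma cabs_conj (z : R[i]) : cabs z^* = cabs z.
Proof. by rewrite /cabs norm_conjC. Qed.

Variable mu : {finite_measure set T -> \bar R}.

Lemma measurable_cLspace (p : \bar R) (g : cLspace mu p) :
  measurable_fun setT (g : T -> borelC R).
Proof. exact: measurable_funPT. Qed.

Lemma cLspace_Lfun (p q : \bar R) (g : cLspace mu q) : (1 <= p)%E ->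
  (p <= q)%E -> (fun x => cabs (g x)) \in Lfun mu p.
Proof.
move=> p1 pq; apply: (@Lfun_subset _ _ _ mu p q) => //.
- exact: le_trans pq.
- exact: fin_num_measure.
apply/andP; split; rewrite inE/=; last exact: cLspace_finite.
by apply: measurable_cabs; exact: measurable_cLspace.
Qed.

Lemma cLnorm_lty (p q : \bar R) (g : cLspace mu q) : (1 <= p)%E ->
  (p <= q)%E -> (cLnorm mu p g < +oo)%E.
Proof.
by move=> p1 pq; have := cLspace_Lfun p q g p1 pq => /andP[_]; rewrite inE.
Qed.

Lemma cLspace_integrable (p : \bar R) (g : cLspace mu p) : (1 <= p)%E ->
  cintegrable mu g.
Proof.
move=> p1; apply: (@cintegrable_le _ _ (fun x => cabs (g x))) => //.
by apply/Lfun1_integrable; exact: cLspace_Lfun.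
Qed.

Lemma cLspace2_integrable (f g : cLspace mu 2%:E) :
  cintegrable mu (fun x => (f x : R[i]) * (g x : R[i])^*).
Proof.
apply: (@cintegrable_le _ _ (fun x => cabs (f x) * cabs (g x))).
- apply: measurable_funMC; first exact: measurable_cLspace.
  by apply: measurable_conjc; exact: measurable_cLspace.
- by move=> x; rewrite cabsM cabs_conj.
- by apply/Lfun1_integrable; apply: Lfun2_mul_Lfun1; apply: cLspace_Lfun;
    rewrite // lee1n.
Qed.

End complex_integrals.

(** * Powers of the position operator *)

Section position_powers.
Context {R : realType}.
Variable mu : {finite_measure set (borelT R) -> \bar R}.
Implicit Types (z : circle R) (k : int) (f g : cLspace mu 2%:E).

Lemma cintegral_cvalX_ReIm (f : circle R -> R[i]) k : cintegrable mu f ->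
  cintegral mu (fun z => cval z ^ k * f z) =
  (\int[mu]_z (trig true k z * complex.Re (f z)) -
   \int[mu]_z (trig false k z * complex.Im (f z))) +i*
  (\int[mu]_z (trig true k z * complex.Im (f z)) +
   \int[mu]_z (trig false k z * complex.Re (f z))).
Proof.
move=> [intr inti].
have intt j (h : circle R -> R) : mu.-integrable setT (EFin \o h) ->
    mu.-integrable setT (EFin \o (fun z => trig j k z * h z)).
  move=> inth; apply: (@integrable_test _ _ _ mu _ _ trig) => //.
    exact: measurable_trig.
  exact: trig_le1.
rewrite -RintegralB//; [|exact: intt..].
rewrite -RintegralD//; [|exact: intt..].
by rewrite /cintegral; congr (_ +i* _); apply: eq_Rintegral => z _;
  rewrite /trig; case: (_ ^ _) => a b; case: (f z).
Qed.

Lemma cst1_cintegrable : cintegrable mu (fun=> 1).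
Proof.
by split=> /=; apply: (@finite_measure_integrable_cst _ _ _ mu).
Qed.

Lemma cintegral_cvalX k : cintegral mu (fun z => cval z ^ k) =
  (\int[mu]_z (trig true k z * 1)) +i* (\int[mu]_z (trig false k z * 1)).
Proof.
by rewrite /cintegral; congr (_ +i* _); apply: eq_Rintegral => z _;
  rewrite mulr1.
Qed.

Lemma Rajchman_vanishing :
  Rajchman mu <-> vanishing mu (F := absz_infty) trig (fun=> 1).
Proof.
split=> [/cvgC0_ReIm[r0 i0]|[_ v]].
  split=> [|j]; first exact: cst1_cintegrable.1.
  case: j; [apply: cvg_trans r0|apply: cvg_trans i0];
    by apply: near_eq_cvg; apply: nearW => k; rewrite cintegral_cvalX.
apply/cvgC0_ReIm; split; [apply: cvg_trans (v true)|apply: cvg_trans (v false)];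
  by apply: near_eq_cvg; apply: nearW => k; rewrite cintegral_cvalX.
Qed.

(** The Riemann-Lebesgue property extends from a Rajchman measure to all the
measures which have an integrable density with respect to it. *)
Lemma Rajchman_cvg0 (f : circle R -> R[i]) : Rajchman mu -> cintegrable mu f ->
  cintegral mu (fun z => cval z ^ k * f z) @[k --> absz_infty] --> (0 : R[i]^o).
Proof.
move=> /Rajchman_vanishing v1 intf; have [intr inti] := intf.
have [_ r0] := vanishing1_integrable mu _ v1 intr.
have [_ i0] := vanishing1_integrable mu _ v1 inti.
apply/cvgC0_ReIm; split.
  rewrite -[X in _ --> X](subr0 (0 : R)).
  under eq_cvg do rewrite cintegral_cvalX_ReIm//=.
  by apply: cvgB; [exact: r0|exact: i0].
rewrite -[X in _ --> X](addr0 (0 : R)).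
under eq_cvg do rewrite cintegral_cvalX_ReIm//=.
by apply: cvgD; [exact: i0|exact: r0].
Qed.

Lemma iter_position_opE n f :
  {ae mu, forall z, iter n (position_op mu) f z = cval z ^+ n * (f z : R[i])}.
Proof.
elim: n => [|n IH]; first by apply: aeW => z; rewrite mul1r.
apply: filterS2 (position_opE (iter n (position_op mu) f)) IH => z /= -> ->.
by rewrite exprS mulrA.
Qed.

Lemma cdot_iter_position_op n f g :
  cdot mu (iter n (position_op mu) f) g =
  cintegral mu (fun z => cval z ^ (n%:Z) * ((f z : R[i]) * (g z : R[i])^*)).
Proof.
have mg := measurable_conjc _ (measurable_cLspace _ _ g).
apply: ae_eq_cintegral.
- by apply: measurable_funMC => //; exact: measurable_cLspace.
- apply: measurable_funMC; first exact: measurable_cvalX.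
  by apply: measurable_funMC => //; exact: measurable_cLspace.
- have := iter_position_opE n f.
  apply: (@filterS _ _ (ae_filter_ringOfSetsType mu)) => z ->.
  by rewrite mulrA.
Qed.

Lemma cabs_cintegral_cvalXN k :
  cabs (cintegral mu (fun z => cval z ^ (- k))) =
  cabs (cintegral mu (fun z => cval z ^ k)).
Proof.
have intt : mu.-integrable setT (EFin \o trig false k).
  have := @integrable_test _ _ _ mu _ _ trig (@measurable_trig R) (@trig_le1 R)
    false k _ cst1_cintegrable.1.
  by under [X in _.-integrable _ X]eq_fun do rewrite /= mulr1.
rewrite -[RHS]cabs_conj /cintegral /=; congr (cabs (_ +i* _)).
  by apply: eq_Rintegral => z _; rewrite cvalXN; case: (_ ^ _).
rewrite -mulN1r -RintegralZl//.
by apply: eq_Rintegral => z _; rewrite cvalXN mulN1r; case: (_ ^ _).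
Qed.

Lemma cvg_absz : absz k @[k --> absz_infty] --> \oo.
Proof. by move=> A [N _ NA]; exists N => k /NA. Qed.

(** As mu is positive, its Fourier coefficients of indices k and - k are
conjugate, so the nonnegative indices suffice. *)
Lemma Rajchman_nat : cintegral mu (fun z => cval z ^ n%:Z) @[n --> \oo]
  --> (0 : R[i]^o) -> Rajchman mu.
Proof.
move=> /cvgC0_cabs n0; apply/cvgC0_cabs.
have E k : cabs (cintegral mu (fun z => cval z ^ k)) =
    cabs (cintegral mu (fun z => cval z ^ (absz k)%:Z)).
  by case: k => // n; rewrite NegzE cabs_cintegral_cvalXN abszN.
under eq_cvg do rewrite E.
exact: (cvg_comp _ _ cvg_absz n0).
Qed.

End position_powers.

(** * The unit function *)

Section unit_function.
Context {R : realType}.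
Variable mu : {finite_measure set (borelT R) -> \bar R}.

(** The class of the constant 1, as in [one_L2]; [one_Linfty] is the same
class seen in L^oo. *)
Definition one_class : {mfun_ mu, borelT R >-> borelC R} :=
  aeclass mu (@measurable_cst _ _ (borelT R) (borelC R) setT (1%R : R[i])).

Lemma one_classE : {ae mu, forall z, one_class z = 1 :> R[i]}.
Proof. exact: aeclassE. Qed.

Lemma one_Linfty_subproof : (cLnorm mu +oo%E one_class < +oo)%E.
Proof.
rewrite /cLnorm unlock; case: ifPn => // mu0.
apply: (@le_lt_trans _ _ 1%E); last exact: ltry.
apply/ess_supP.
apply: (@filterS _ _ (ae_filter_ringOfSetsType mu)) one_classE => z /= ->.
by rewrite cabs1 normr1.
Qed.

Definition one_Linfty : cLspace mu +oo%E := CLspace one_Linfty_subproof.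

Lemma cintegral_cvalX_one k (h : circle R -> R[i]) :
  measurable_fun setT (h : borelT R -> borelC R) ->
  {ae mu, forall z, h z = 1} ->
  cintegral mu (fun z => cval z ^ k * h z) = cintegral mu (fun z => cval z ^ k).
Proof.
move=> mh h1; apply: ae_eq_cintegral.
- by apply: measurable_funMC => //; exact: measurable_cvalX.
- exact: measurable_cvalX.
- apply: (@filterS _ _ (ae_filter_ringOfSetsType mu)) h1 => z ->.
  by rewrite mulr1.
Qed.
End unit_function.

(** * The equivalence *)

Theorem proposition5p3 (R : realType)
    (mu : {finite_measure set (borelT R) -> \bar R}) :
  [<-> (* (a) *) Rajchman mu ;
   (* (b) *)
   forall p : R, 1 <= p -> forall g : cLspace mu p%:E,
     cintegral mu (fun z => cval z ^ k * (g z : R[i])) @[k --> absz_infty]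
       --> (0 : R[i]^o) ;
   (* (c) *)
   exists2 p : R, 1 <= p & forall g : cLspace mu p%:E,
     cintegral mu (fun z => cval z ^ k * (g z : R[i])) @[k --> absz_infty]
       --> (0 : R[i]^o) ;
   (* (d) *)
   forall g : cLspace mu +oo%E, {ae mu, forall z, 0 < (g z : R[i])} ->
     cintegral mu (fun z => cval z ^ k * (g z : R[i])) @[k --> absz_infty]
       --> (0 : R[i]^o) ;
   (* (e) *)
   weakly_stable (cdot mu) (position_op mu) ;
   (* (f) *)
   forall psi : cLspace mu +oo%E,
     {ae mu, forall z, 0 < `|(psi z : R[i])|} ->
     cdot mu (iter n (position_op mu) (Linfty_L2 psi)) (Linfty_L2 psi)
       @[n --> \oo] --> (0 : R[i]^o) ;
   (* (g) *)
   cdot mu (iter n (position_op mu) (one_L2 mu)) (one_L2 mu)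
     @[n --> \oo] --> (0 : R[i]^o)
  ].
Proof.
tfae.
- move=> mu0 p p1 g; apply: Rajchman_cvg0 => //.
  by apply: cLspace_integrable; rewrite lee_fin.
- by move=> mu0; exists 1 => // g; exact: mu0.
- move=> [p p1 mu0] g _.
  have p1e : (1 <= p%:E)%E by rewrite lee_fin.
  exact: (mu0 (CLspace (cLnorm_lty mu _ _ g p1e (leey _)))).
- move=> mu0 f g.
  (* the unit function is positive *)
  have muR : Rajchman mu.
    have g1 : {ae mu, forall z, 0 < (one_Linfty mu z : R[i])}.
      apply: (@filterS _ _ (ae_filter_ringOfSetsType mu)) (one_classE mu).
      by move=> z /= ->; exact: ltr01.
    apply: cvg_trans (mu0 _ g1); apply: near_eq_cvg; apply: nearW => k /=.
    by rewrite cintegral_cvalX_one//; exact: one_classE.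
  have /cvgC0_cabs fg0 := Rajchman_cvg0 mu _ muR (cLspace2_integrable mu f g).
  under eq_cvg do rewrite cdot_iter_position_op.
  apply: (@cvg_comp _ _ _ Posz _ _ absz_infty _ _ fg0).
  by move=> A [N NA]; exists N => // n Nn; exact: (NA n%:Z Nn).
- by move=> mu0 psi _; apply/cvgC0_cabs; exact: mu0.
- move=> mu0.
  have g1 : {ae mu, forall z, 0 < `|one_Linfty mu z : R[i]|}.
    apply: (@filterS _ _ (ae_filter_ringOfSetsType mu)) (one_classE mu).
    by move=> z /= ->; rewrite normr1 ltr01.
  apply: cvg_trans (mu0 _ g1); apply: near_eq_cvg; apply: nearW => n /=.
  by rewrite !cdot_iter_position_op.
- move=> mu0; apply: Rajchman_nat; apply: cvg_trans mu0; apply: near_eq_cvg.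
  apply: nearW => n /=; rewrite cdot_iter_position_op cintegral_cvalX_one//.
    apply: measurable_funMC => //; exact: measurable_conjc.
  apply: (@filterS _ _ (ae_filter_ringOfSetsType mu)) (one_classE mu) => z /=.
  by rewrite /one_L2 /= => ->; rewrite rmorph1 mulr1.
Qed.
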